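(* Let $n\ge 3$ and let $x_1,x_2,\dots,x_n$ be $n$ positive real numbers, with arithmetic mean $A$, geometric mean $G$, harmonic mean $H$ and second moment $m_2'$. Then $$G\leq \left(\frac{G^{n}}{H}\right)^{\frac{1}{n-1}}\leq \sqrt{\frac{nA^{2}-m_{2}'}{n-1}}\leq A.$$
   Context: For positive real numbers $x_1,\dots,x_n$: $A=\frac1n\sum_{i=1}^n x_i$, $G=\left(\prod_{i=1}^n x_i\right)^{1/n}$, $H=\left(\frac1n\sum_{i=1}^n\frac1{x_i}\right)^{-1}$, and $m_2'=\frac1n\sum_{i=1}^n x_i^2$. *)

(* Defs.v *)
From mathcomp Require Import all_boot all_order all_algebra.
From mathcomp Require Import reals exp.

Set Implicit Arguments.
Unset Strict Implicit.
Unset Printing Implicit Defensive.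

Import Order.TTheory GRing.Theory Num.Theory.
Local Open Scope ring_scope.

Definition arith_mean (R : realType) (n : nat) (x : 'I_n -> R) : R :=
  n%:R^-1 * \sum_(i < n) x i.

Definition geom_mean (R : realType) (n : nat) (x : 'I_n -> R) : R :=
  (\prod_(i < n) x i) `^ (n%:R^-1).

Definition harm_mean (R : realType) (n : nat) (x : 'I_n -> R) : R :=
  (n%:R^-1 * \sum_(i < n) (x i)^-1)^-1.

(* The raw moment m_2', not centered at the mean. *)
Definition second_moment (R : realType) (n : nat) (x : 'I_n -> R) : R :=
  n%:R^-1 * \sum_(i < n) x i ^+ 2.

(* Main.v *)
Require Import Defs.
From mathcomp Require Import all_boot all_order all_algebra.
From mathcomp Require Import reals exp.
From mathcomp Require Import ring lra.

Import Order.TTheory GRing.Theory Num.Theory.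
Local Open Scope ring_scope.

(** With [e_k] the elementary symmetric polynomials, [G^n / H] is [e_(n-1) / n]
    and [(n A^2 - m2') / (n - 1)] is [e_2 / 'C(n, 2)].  The outer inequalities
    are AM-GM for the [1 / x_i] and Cauchy-Schwarz.  The middle one is
    Maclaurin's inequality between [e_(n-1)] and [e_2], proved by induction on
    [n] from the equality case [n = 3]: if [b^2] is the mean of the pairwise
    products of [n] variables, then their product is at most [b^n] and their
    sum at least [n b], so that adding a variable [y] reduces the claim to
    [(1 + n t) / (n + 1) <= ((n - 1 + 2 t) / (n + 1)) ^ (n / 2)] for
    [t = y / b], which is Bernoulli's inequality. *)

(* Bernoulli's inequality [1 + (n / 2) (s - 1) <= s ^ (n / 2)] for [s = u^2]. *)
Lemma bernoulli_half (R : realFieldType) (n : nat) (u : R) :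
  (2 <= n)%N -> 0 <= u -> 2 + n%:R * (u ^+ 2 - 1) <= 2 * u ^+ n.
Proof.
case: n => [|[|n]] // _ u0; elim: n => [|n IHn]; first by lra.
have m1 : 1 <= n.+2%:R :> R by rewrite ler1n.
rewrite [u ^+ n.+3]exprS -[n.+3%:R]natr1; move: m1 (ler_wpM2l u0 IHn).
move: (u ^+ n.+2) (n.+2%:R) => v m m1 {}IHn.
(* This product is exactly the slack left after multiplying the induction hypothesis by [u]. *)
have gap : 0 <= (u - 1) ^+ 2 * (m * u + (m - 1)).
  by apply: mulr_ge0; [exact: sqr_ge0 | rewrite addr_ge0 ?mulr_ge0; lra].
lra.
Qed.

(** Cauchy-Schwarz against the constant 1: with [S] the sum and [Q] the sum of squares, the squares
    of [n x_i - S] add up to [n (n Q - S^2)]. *)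
Lemma sqr_sum_le (R : realFieldType) (n : nat) (x : 'I_n -> R) :
  (\sum_(i < n) x i) ^+ 2 <= n%:R * \sum_(i < n) x i ^+ 2.
Proof.
case: n x => [|n] x; first by rewrite !big_ord0 expr0n mulr0.
set S := \sum_(i < _) x i; set Q := \sum_(i < _) _.
have N0 : 0 < n.+1%:R :> R by [].
have : 0 <= \sum_(i < n.+1) (n.+1%:R * x i - S) ^+ 2.
  by apply: sumr_ge0 => i _; exact: sqr_ge0.
under eq_bigr => i _.
  rewrite (_ : _ ^+ 2 = n.+1%:R ^+ 2 * x i ^+ 2 - 2 * n.+1%:R * S * x i + S ^+ 2);
    last by ring.
  over.
rewrite big_split /= sumrB -!mulr_sumr -/S -/Q sumr_const card_ord -[S *+ _]mulr_natl.
rewrite (_ : _ + _ = n.+1%:R * (n.+1%:R * Q - S ^+ 2)); last by ring.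
by rewrite pmulr_rge0 // subr_ge0.
Qed.

Lemma prod_inv_le_mean (R : realFieldType) (n : nat) (x : 'I_n -> R) :
  (forall i, 0 < x i) ->
  (\prod_(i < n) x i)^-1 <= ((\sum_(i < n) (x i)^-1) / n%:R) ^+ n.
Proof.
move=> x0; have := @leif_AGM R _ 'I_n (fun i => (x i)^-1).
case=> [i _|+ _]; first by rewrite invr_ge0 ltW.
by rewrite card_ord prodfV.
Qed.

(** For [N = n + 2] variables, AM-GM on the inverses gives [P^(N-1) <= (P T / N)^N <= (b^(N-1))^N];
    then take [(N-1)]-th roots. *)
Lemma prod_le_exp (R : realFieldType) (n : nat) (x : 'I_n.+2 -> R) (b : R) :
  (forall i, 0 < x i) -> 0 <= b ->
  (\prod_(i < n.+2) x i) * (\sum_(i < n.+2) (x i)^-1) / n.+2%:R <= b ^+ n.+1 ->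
  \prod_(i < n.+2) x i <= b ^+ n.+2.
Proof.
move=> x0 b0; set P := \prod_(i < _) x i; set T := \sum_(i < _) _ => leb.
have P0 : 0 < P by exact: prodr_gt0.
have T0 : 0 <= T by apply: sumr_ge0 => i _; rewrite invr_ge0 ltW.
have N0 : 0 < n.+2%:R :> R by [].
have step : P ^+ n.+1 <= (P * T / n.+2%:R) ^+ n.+2.
  rewrite -mulrA exprMn [P ^+ n.+2]exprSr -mulrA ler_peMr ?exprn_ge0 ?(ltW P0) //.
  by rewrite -ler_pdivrMl // mulr1; exact: prod_inv_le_mean.
rewrite -(@ler_pXn2r _ n.+1) ?nnegrE ?exprn_ge0 ?(ltW P0) //.
apply: le_trans step _; rewrite exprAC ler_pXn2r // ?nnegrE ?exprn_ge0 //.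
by rewrite divr_ge0 ?mulr_ge0 // ltW.
Qed.

Lemma maclaurin_penultimate (R : rcfType) (n : nat) (x : 'I_n.+3 -> R) :
  (forall i, 0 < x i) ->
  (\prod_(i < n.+3) x i) * (\sum_(i < n.+3) (x i)^-1) / n.+3%:R <=
  Num.sqrt (((\sum_(i < n.+3) x i) ^+ 2 - \sum_(i < n.+3) x i ^+ 2) /
            (n.+3%:R * n.+2%:R)) ^+ n.+2.
Proof.
elim: n x => [|n IHn] x x0.
  rewrite !big_ord_recr !big_ord0 /=.
  set a := x _; set b := x _; set c := x _.
  have [a0 b0 c0] : [/\ 0 < a, 0 < b & 0 < c] by split; exact: x0.
  have [ab0 bc0 ac0] : [/\ 0 < a * b, 0 < b * c & 0 < a * c].
    by split; exact: mulr_gt0.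
  (* For three variables [e_(n-1)] is [e_2], and the square cancels the root. *)
  rewrite (_ : _ / (_ * _) = (a * b + b * c + a * c) / 3); last by field.
  rewrite sqr_sqrtr; last by lra.
  by rewrite le_eqVlt; apply/orP; left; apply/eqP; field; rewrite !gt_eqF.
pose z i := x (widen_ord (leqnSn n.+3) i).
have z0 i : 0 < z i by exact: x0.
rewrite ![\sum_(i < n.+4) _]big_ord_recr ![\prod_(i < n.+4) _]big_ord_recr /=.
move: (x ord_max) (x0 ord_max) => y y0.
have := sqr_sum_le _ _ z; have := prod_le_exp _ _ z _ z0; have := IHn z z0.
have : 0 < \prod_(i < n.+3) z i by exact: prodr_gt0.
have : 0 < \sum_(i < n.+3) (z i)^-1.
  rewrite big_ord_recl ltr_pwDl ?invr_gt0 ?sumr_ge0 // => i _.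
  by rewrite invr_ge0 ltW.
have : 0 < \sum_(i < n.+3) z i.
  by rewrite big_ord_recl ltr_pwDl ?sumr_ge0 // => i _; rewrite ltW.
rewrite -/(z _).
set S := \sum_(i < _) z i; set P := \prod_(i < _) z i.
set Q := \sum_(i < _) z i ^+ 2; set T := \sum_(i < _) (z i)^-1.
change (\sum_(i < n.+3) x _) with S; change (\prod_(i < n.+3) x _) with P.
change (\sum_(i < n.+3) x _ ^+ 2) with Q.
change (\sum_(i < n.+3) (x _)^-1) with T.
move=> S0 T0 P0 PTb Pb CS.
have N3 : 0 < n.+3%:R :> R by [].
have N2 : 0 < n.+2%:R :> R by [].
have N4 : 0 < n.+4%:R :> R by [].
set b := Num.sqrt _ in PTb.
(* [Num.sqrt] is 0 on negative numbers, so [b = 0] must be excluded: the induction hypothesis bounds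
   a positive quantity by a power of [b]. Positivity of the radicand follows. *)
have b_gt0 : 0 < b.
  rewrite lt_neqAle sqrtr_ge0 andbT eq_sym; apply/eqP => b0.
  have : 0 < P * T / n.+3%:R by rewrite divr_gt0 ?mulr_gt0.
  by rewrite ltNge (le_trans PTb) // b0 expr0n.
have {}Pb := Pb b (ltW b_gt0) PTb.
have SQ0 : 0 <= (S ^+ 2 - Q) / (n.+3%:R * n.+2%:R).
  by rewrite ltW // -sqrtr_gt0.
have b2 : b ^+ 2 * (n.+3%:R * n.+2%:R) = S ^+ 2 - Q.
  by rewrite sqr_sqrtr // divfK // gt_eqF ?mulr_gt0.
have N32 : n.+3%:R = n.+2%:R + 1 :> R by rewrite -natr1.
have N43 : n.+4%:R = n.+3%:R + 1 :> R by rewrite -natr1.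
(* By Cauchy-Schwarz, [(n+3) (S^2 - Q) <= (n+2) S^2]. *)
have bS : n.+3%:R * b <= S.
  rewrite -(@ler_pXn2r _ 2) ?nnegrE ?(ltW S0) ?(ltW (mulr_gt0 N3 b_gt0)) //.
  rewrite -(ler_pM2l N2); nra.
(* The mean of the pairwise products once [y] is added: [e_2] grows by [S y]. *)
set c2 := _ / (n.+4%:R * _).
have c2E : c2 * (n.+4%:R * n.+3%:R) = b ^+ 2 * (n.+3%:R * n.+2%:R) + 2 * (S * y).
  by rewrite divfK ?gt_eqF ?mulr_gt0 // b2; ring.
have c2_ge : n.+2%:R * b ^+ 2 + 2 * (b * y) <= n.+4%:R * c2.
  rewrite -(ler_pM2l N3).
  have := ler_wpM2r (ltW y0) bS; nra.
have c2_ge0 : 0 <= c2.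
  rewrite -(pmulr_rge0 _ N4); apply: le_trans c2_ge.
  by rewrite addr_ge0 ?mulr_ge0 ?exprn_ge0 // ltW.
set c := Num.sqrt c2; pose u := c / b.
have u0 : 0 <= u by rewrite divr_ge0 ?sqrtr_ge0 // ltW.
have cE : c = u * b by rewrite divfK ?gt_eqF.
have u2 : c2 = u ^+ 2 * b ^+ 2 by rewrite -exprMn -cE sqr_sqrtr.
(* With [t = y / b], this is [(n + 2 + 2 t) / (n + 4) <= u^2], the lower bound to be fed into
   Bernoulli's inequality. *)
have t_le : n.+2%:R * b + 2 * y <= n.+4%:R * (u ^+ 2 * b).
  rewrite -(ler_pM2l b_gt0); move: c2_ge; rewrite u2; nra.
(* The new [e_(n+3)] splits into the products containing [y], bounded by the induction hypothesis,
   and the single one without it, bounded by [prod_le_exp]. *)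
rewrite (_ : P * y * (T + y^-1) = P * T * y + P); last by field; rewrite gt_eqF.
rewrite cE exprMn ler_pdivrMr //.
have {}PTb : P * T <= n.+3%:R * b ^+ n.+2 by rewrite [leRHS]mulrC -ler_pdivrMr.
have le1 : P * T * y + P <= b ^+ n.+2 * (n.+3%:R * y + b).
  have := ler_wpM2r (ltW y0) PTb; move: Pb; rewrite exprS; nra.
apply: le_trans le1 _.
rewrite (_ : _ * n.+4%:R = b ^+ n.+2 * (u ^+ n.+3 * n.+4%:R * b));
  last by rewrite [b ^+ n.+3]exprS; ring.
rewrite ler_pM2l ?exprn_gt0 //.
have bern := bernoulli_half _ n.+3 u isT u0.
have := ler_wpM2l (ltW (mulr_gt0 N4 b_gt0)) bern.
have := ler_wpM2l (ltW N3) t_le.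
move: N32 N43; set w := u ^+ n.+3; move: n.+2%:R => m -> ->.
lra.
Qed.

Theorem theorem2p3 (R : realType) (n : nat) (x : 'I_n -> R)
    (hn : (3 <= n)%N) (hx : forall i : 'I_n, 0 < x i) :
  let A := arith_mean x in
  let G := geom_mean x in
  let H := harm_mean x in
  let m2' := second_moment x in
  [/\ G <= (G ^+ n / H) `^ (1 / (n%:R - 1)),
      (G ^+ n / H) `^ (1 / (n%:R - 1)) <=
        Num.sqrt ((n%:R * A ^+ 2 - m2') / (n%:R - 1)) &
      Num.sqrt ((n%:R * A ^+ 2 - m2') / (n%:R - 1)) <= A].
Proof.
case: n x hn hx => [|[|[|n]]] // x _ x0 A G H m2'.
set P := \prod_(i < n.+3) x i; set S := \sum_(i < n.+3) x i.
set Q := \sum_(i < n.+3) x i ^+ 2; set T := \sum_(i < n.+3) (x i)^-1.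
have N3 : 0 < n.+3%:R :> R by [].
have N2 : 0 < n.+2%:R :> R by [].
have P0 : 0 < P by exact: prodr_gt0.
have T0 : 0 <= T by apply: sumr_ge0 => i _; rewrite invr_ge0 ltW.
have S0 : 0 <= S by apply: sumr_ge0 => i _; rewrite ltW.
have N32 : n.+3%:R - 1 = n.+2%:R :> R by rewrite -natr1 addrK.
have G0 : 0 < G by rewrite powR_gt0.
have GP : G ^+ n.+3 = P.
  by rewrite -powR_mulrn ?powR_ge0 // -powRrM mulVf ?gt_eqF // powRr1 // ltW.
have GHE : G ^+ n.+3 / H = P * T / n.+3%:R.
  by rewrite GP /H /harm_mean invrK -/T mulrA mulrAC.
have GH0 : 0 <= P * T / n.+3%:R by rewrite divr_ge0 ?mulr_ge0 // ltW.
have rootK a : 0 <= a -> (a ^+ n.+2) `^ (1 / n.+2%:R) = a.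
  by move=> a0; rewrite -powR_mulrn // -powRrM div1r mulfV ?gt_eqF // powRr1.
have e2E : (n.+3%:R * A ^+ 2 - m2') / n.+2%:R =
           (S ^+ 2 - Q) / (n.+3%:R * n.+2%:R).
  rewrite /A /m2' /arith_mean /second_moment -/S -/Q.
  by field; rewrite -!natrD !pnatr_eq0.
rewrite GHE N32 e2E; split.
- rewrite -[leLHS]rootK ?(ltW G0) //.
  apply: ge0_ler_powR; rewrite ?nnegrE ?exprn_ge0 ?(ltW G0) //.
    by rewrite divr_ge0.
  (* Comparing the bases amounts to [H <= G], in inverted form. *)
  have GT : G^-1 <= T / n.+3%:R.
    rewrite -(@ler_pXn2r _ n.+3) ?nnegrE ?invr_ge0 ?divr_ge0 ?(ltW G0) //.
    by rewrite exprVn GP; exact: prod_inv_le_mean.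
  by rewrite -GP [G ^+ n.+3]exprSr -2!mulrA ler_peMr ?exprn_ge0 ?(ltW G0) //
     -ler_pdivrMl // mulr1.
- rewrite -[leRHS]rootK ?sqrtr_ge0 //.
  apply: ge0_ler_powR; rewrite ?nnegrE ?exprn_ge0 ?sqrtr_ge0 //.
    by rewrite divr_ge0.
  exact: maclaurin_penultimate.
- have A0 : 0 <= A by rewrite mulr_ge0 ?invr_ge0 // ltW.
  rewrite -[leRHS]ger0_norm // -sqrtr_sqr ler_wsqrtr //.
  (* Bounding the radicand by [A^2] amounts to [A^2 <= m2'], which is Cauchy-Schwarz. *)
  rewrite ler_pdivrMr ?mulr_gt0 //.
  have := sqr_sum_le _ _ x; rewrite -/S -/Q.
  have AS : S = n.+3%:R * A by rewrite /A /arith_mean mulVKf ?gt_eqF.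
  rewrite AS => CS; rewrite -(ler_pM2l N3) -N32; nra.
Qed.
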